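(* Let $\mathfrak{g}$ be a finite-dimensional real Lie algebra with an invariant inner product $\langle\,,\rangle_{\mathfrak{g}}$ and let $W$ be a 2-dimensional commutative associative real algebra with unit. Let $\theta:W\to\mathbb{R}$ be a linear form such that the symmetric bilinear form $\langle w_1,w_2\rangle_W:=\theta(w_1w_2)$ on $W$ is non-degenerate and indefinite. Let $V^0_+\subset W$ be a 1-dimensional subspace on which $\langle\,,\rangle_W$ is positive definite, let $V^0_-:=(V^0_+)^\perp$ be its orthogonal complement with respect to $\langle\,,\rangle_W$, and let $e_+\in V^0_+$ and $e_-\in V^0_-$ be non-zero elements. Let $\mathfrak{d}:=\mathfrak{g}\otimes W$ with the Lie bracket $[X_1\otimes w_1,X_2\otimes w_2]_{\mathfrak{d}}=[X_1,X_2]_{\mathfrak{g}}\otimes w_1w_2$, and let $V_\pm:=\mathfrak{g}\otimes V^0_\pm\subset\mathfrak{d}$. If a linear form $q:W\to\mathbb{R}$ satisfies $$q(e_+)\,q(e_-)=q(e_+e_-),$$ then the linear map $p=\operatorname{id}_{\mathfrak{g}}\otimes q:\mathfrak{d}\to\mathfrak{g}$ satisfies $$[p(X),p(Y)]_{\mathfrak{g}}=p([X,Y]_{\mathfrak{d}})\qquad\forall X\in V_+,\ Y\in V_-.$$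
   Context: Tensor products are over $\mathbb{R}$. The map $\operatorname{id}_{\mathfrak{g}}\otimes q:\mathfrak{g}\otimes W\to\mathfrak{g}$ is given by $x\otimes w\mapsto q(w)\,x$. The Lie algebra $\mathfrak{d}$ carries the invariant pairing $\langle X_1\otimes w_1,X_2\otimes w_2\rangle:=\langle X_1,X_2\rangle_{\mathfrak{g}}\,\theta(w_1w_2)$, with respect to which $V_-=(V_+)^\perp$. *)

(* Defs.v *)
From HB Require Import structures.
From mathcomp Require Import all_boot all_order all_algebra.

Set Implicit Arguments.
Unset Strict Implicit.
Unset Printing Implicit Defensive.

Import Order.TTheory GRing.Theory Num.Theory.
Import VectorInternalTheory.
Local Open Scope ring_scope.

Reserved Notation "[ 'lie' x , y ]"
  (at level 0, x at level 99, y at level 99, format "[ 'lie'  x ,  y ]").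
Reserved Notation "u ⊗ v" (at level 40, left associativity).

HB.mixin Record Vector_isLieAlgebra (K : fieldType) (L : Type)
    of Vector K L := {
  lie : L -> L -> L;
  lie_linearl : forall y, linear (lie^~ y);
  lie_linearr : forall x, linear (lie x);
  liexx : forall x, lie x x = 0;
  lie_jacobi : forall x y z,
    lie x (lie y z) + lie y (lie z x) + lie z (lie x y) = 0
}.

#[short(type="lieAlgType")]
HB.structure Definition LieAlgebra (K : fieldType) :=
  { L of Vector_isLieAlgebra K L & Vector K L }.

Notation "[ 'lie' x , y ]" := (lie x y) : ring_scope.

Section LieTheory.
Variables (K : fieldType) (g : lieAlgType K).
Implicit Types x y z : g.

HB.instance Definition _ := @bilinear_isBilinear.Build K g g g *:%R *:%R
  (@lie K g) (@lie_linearl K g, @lie_linearr K g).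

Lemma lieC x y : [lie x, y] + [lie y, x] = 0.
Proof.
have := liexx (x + y); rewrite linearDl /= !linearDr /= !liexx.
by rewrite addr0 add0r.
Qed.

End LieTheory.

(* Commutative associative unital algebras of finite dimension; unlike         *)
(* falgType, no inverse operation is part of the structure.                    *)
#[short(type="finComAlgType")]
HB.structure Definition FinComAlgebra (K : fieldType) :=
  { A of GRing.ComAlgebra K A & Vector K A }.

Section TraceForm.
Variables (K : fieldType) (W : finComAlgType K) (theta : {scalar W}).

Definition trace_form (w1 w2 : W) : K := theta (w1 * w2).

Fact trace_form_bilinear : bilinear_for *%R (idfun \; *%R) trace_form.
Proof.
split=> w a x y; rewrite /trace_form.
  by rewrite mulrDl -scalerAl linearP.
by rewrite mulrDr -scalerAr linearP.
Qed.

HB.instance Definition _ :=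
  @bilinear_isBilinear.Build K W W K *%R (idfun \; *%R) trace_form
    trace_form_bilinear.

Fact trace_form_sym (w1 w2 : W) :
  trace_form w1 w2 = (-1) ^+ false * idfun (trace_form w2 w1).
Proof. by rewrite expr0 mul1r /trace_form mulrC. Qed.

HB.instance Definition _ :=
  @isHermitianSesquilinear.Build K W false idfun trace_form trace_form_sym.

End TraceForm.

Definition indefinite (R : numDomainType) (U : lmodType R) (f : U -> U -> R) :=
  (exists u, 0 < f u u) /\ (exists u, f u u < 0).

(* The tensor product of two finite dimensional spaces is realized as a space  *)
(* of matrices, through the coordinates v2r of the two factors. That this is   *)
(* the tensor product is the content of tlift_linear and tlift_tens (existence *)
(* in the universal property) and tensor_ext (uniqueness).                     *)
Definition tensor (K : fieldType) (U V : vectType K) : Type :=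
  'M[K]_(dim U, dim V).

HB.instance Definition _ (K : fieldType) (U V : vectType K) :=
  Vector.copy (tensor U V) 'M[K]_(dim U, dim V).

Definition tens (K : fieldType) (U V : vectType K) (u : U) (v : V) :
  tensor U V := (v2r u)^T *m v2r v.

Notation "u ⊗ v" := (tens u v) : ring_scope.

(* The linear map with u ⊗ v |-> f u v, for f bilinear.                        *)
Definition tlift (K : fieldType) (U V : vectType K) (Z : lmodType K)
    (f : U -> V -> Z) (X : tensor U V) : Z :=
  \sum_i \sum_j X i j *: f (r2v 'e_i) (r2v 'e_j).

(* U0 ⊗ V0 as a subspace of U ⊗ V; see memv_tensv and tensv_subP.              *)
Definition tensv (K : fieldType) (U V : vectType K)
    (U0 : {vspace U}) (V0 : {vspace V}) : {vspace tensor U V} :=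
  <<[seq u ⊗ v | u <- vbasis U0, v <- vbasis V0]>>%VS.

Section TensorTheory.
Variables (K : fieldType) (U V : vectType K).
Implicit Types (u : U) (v : V) (X Y : tensor U V).

Fact tens_bilinear : bilinear_for *:%R *:%R (@tens K U V).
Proof.
split=> w a x y; rewrite /tens.
  by rewrite !linearP /= mulmxDl scalemxAl.
by rewrite linearP /= mulmxDr scalemxAr.
Qed.

HB.instance Definition _ := @bilinear_isBilinear.Build K U V (tensor U V)
  *:%R *:%R (@tens K U V) tens_bilinear.

Lemma tensor_sum X : X = \sum_i \sum_j X i j *: (r2v 'e_i ⊗ r2v 'e_j).
Proof.
rewrite [LHS]matrix_sum_delta; apply: eq_bigr => i _; apply: eq_bigr => j _.
by rewrite /tens !r2vK trmx_delta mul_delta_mx.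
Qed.

Lemma tensor_ind (P : tensor U V -> Prop) :
    (forall u v, P (u ⊗ v)) -> (forall X Y, P X -> P Y -> P (X + Y)) ->
  forall X, P X.
Proof.
move=> Pt PD X; have P0 : P 0 by have := Pt 0 0; rewrite linear0l.
rewrite [X]tensor_sum; apply: (big_ind P) => [//|//|i _].
apply: (big_ind P) => [//|//|j _].
have := Pt (X i j *: r2v 'e_i) (r2v 'e_j); by rewrite linearZl_LR.
Qed.

Section Lift.
Variable Z : lmodType K.

Lemma tensor_ext (F G : {linear tensor U V -> Z}) :
  (forall u v, F (u ⊗ v) = G (u ⊗ v)) -> F =1 G.
Proof.
move=> FG; apply: tensor_ind => // X Y FX FY.
by rewrite !linearD FX FY.
Qed.

Variable f : U -> V -> Z.

Fact tlift_linear : linear (tlift f).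
Proof.
move=> a X Y; rewrite /tlift scaler_sumr -big_split; apply: eq_bigr => i _ /=.
rewrite scaler_sumr -big_split; apply: eq_bigr => j _ /=.
by rewrite !mxE scalerDl scalerA.
Qed.

HB.instance Definition _ :=
  GRing.isLinear.Build K (tensor U V) Z *:%R (tlift f) tlift_linear.

Lemma tlift_tens : (forall v, linear (f^~ v)) -> (forall u, linear (f u)) ->
  forall u v, tlift f (u ⊗ v) = f u v.
Proof.
move=> fl fr u v.
have row_r2v (T : vectType K) (t : T) : t = \sum_i v2r t 0 i *: r2v 'e_i.
  rewrite -[LHS]v2rK [v2r t in LHS]row_sum_delta linear_sum.
  by apply: eq_bigr => i _; rewrite linearZ.
pose h := fun v' => f^~ v'.
pose Fl v' := GRing.isLinear.Build K U Z *:%R (h v') (fl v').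
pose FL v' : {linear U -> Z} := HB.pack (h v') (Fl v').
pose Fr u' := GRing.isLinear.Build K V Z *:%R (f u') (fr u').
pose FR u' : {linear V -> Z} := HB.pack (f u') (Fr u').
have -> : f u v = \sum_i v2r u 0 i *: f (r2v 'e_i) v.
  rewrite [u in LHS]row_r2v -[LHS]/(FL v _) linear_sum.
  by apply: eq_bigr => i _; rewrite linearZ.
apply: eq_bigr => i _; rewrite [v in RHS]row_r2v -[X in _ *: X]/(FR _ _).
rewrite linear_sum scaler_sumr; apply: eq_bigr => j _.
by rewrite linearZ scalerA /tens mxE big_ord1 mxE.
Qed.

End Lift.

Lemma memv_tensv (U0 : {vspace U}) (V0 : {vspace V}) u v :
  u \in U0 -> v \in V0 -> u ⊗ v \in tensv U0 V0.
Proof.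
move=> /coord_vbasis-> /coord_vbasis->.
rewrite linear_sumlz; apply: memv_suml => i _.
rewrite linear_sumr; apply: memv_suml => j _.
rewrite linearZl_LR memvZ // linearZr_LR memvZ // memv_span //.
by apply: allpairs_f; rewrite mem_nth ?size_tuple.
Qed.

Lemma tensv_subP (U0 : {vspace U}) (V0 : {vspace V}) (A : {vspace tensor U V}) :
  reflect {in U0 & V0, forall u v, u ⊗ v \in A} (tensv U0 V0 <= A)%VS.
Proof.
apply: (iffP idP) => [/subvP sA u v uU vV | tA]; first by rewrite sA ?memv_tensv.
apply/span_subvP => _ /allpairsP[[u v] /= [uU vV ->]].
by apply: tA; apply: vbasis_mem.
Qed.

(* The map id ⊗ q : U ⊗ V -> U, with u ⊗ v |-> q v *: u.                       *)
Definition id_tensor (q : {scalar V}) : tensor U V -> U :=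
  tlift (fun u v => q v *: u).

HB.instance Definition _ (q : {scalar V}) :=
  GRing.Linear.copy (id_tensor q) (tlift (fun u v => q v *: u)).

Lemma id_tensorE (q : {scalar V}) u v : id_tensor q (u ⊗ v) = q v *: u.
Proof.
rewrite /id_tensor tlift_tens // => [w|w] a x y /=.
  by rewrite scalerDr !scalerA mulrC.
by rewrite linearP scalerDl scalerA.
Qed.

End TensorTheory.

Section TensorLie.
Variables (K : fieldType) (g : lieAlgType K) (W : finComAlgType K).
Implicit Types (x y z : g) (u v w : W) (X Y Z : tensor g W).

(* The bracket of g ⊗ W, determined by lie_tens below.                         *)
Definition tlie X Y : tensor g W :=
  tlift (fun x1 w1 => tlift (fun x2 w2 => [lie x1, x2] ⊗ (w1 * w2)) Y) X.

Let tlie_in x u : {linear tensor g W -> tensor g W} :=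
  tlift (fun y v => [lie x, y] ⊗ (u * v)).

Let tlie_inE x u y v : tlie_in x u (y ⊗ v) = [lie x, y] ⊗ (u * v).
Proof.
rewrite /= tlift_tens // => [w|w] a z t /=.
  by rewrite linearPr /= linearPl.
by rewrite mulrDr -scalerAr linearPr.
Qed.

Let tlie_linl Y u : linear (fun x => tlie_in x u Y).
Proof.
move=> a x z; elim/tensor_ind: Y => [y v|Y1 Y2 IH1 IH2].
  by rewrite !tlie_inE linearPl /= linearPl.
by rewrite !linearD IH1 IH2 addrACA.
Qed.

Let tlie_linr Y x : linear (fun u => tlie_in x u Y).
Proof.
move=> a u w; elim/tensor_ind: Y => [y v|Y1 Y2 IH1 IH2].
  by rewrite !tlie_inE mulrDl -scalerAl linearPr.
by rewrite !linearD IH1 IH2 addrACA.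
Qed.

Let tlie_tensl x u Y : tlie (x ⊗ u) Y = tlie_in x u Y.
Proof.
rewrite /tlie tlift_tens // => [v|y]; first exact: tlie_linl.
exact: tlie_linr.
Qed.

Lemma tlie_tens x y u v : tlie (x ⊗ u) (y ⊗ v) = [lie x, y] ⊗ (u * v).
Proof. by rewrite tlie_tensl tlie_inE. Qed.

Fact tlie_linearl Y : linear (tlie^~ Y).
Proof. exact: tlift_linear. Qed.

Fact tlie_linearr X : linear (tlie X).
Proof.
move=> a Y Z; elim/tensor_ind: X => [x u|X1 X2 IH1 IH2].
  by rewrite !tlie_tensl linearP.
have D (T : tensor g W) : tlie (X1 + X2) T = tlie X1 T + tlie X2 T.
  by have := tlie_linearl T 1 X1 X2; rewrite !scale1r.
by rewrite !D IH1 IH2 scalerDr addrACA.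
Qed.

Let tlieDl X Y Z : tlie (X + Y) Z = tlie X Z + tlie Y Z.
Proof. by have := tlie_linearl Z 1 X Y; rewrite !scale1r. Qed.

Let tlieDr X Y Z : tlie X (Y + Z) = tlie X Y + tlie X Z.
Proof. by have := tlie_linearr X 1 Y Z; rewrite !scale1r. Qed.

Let tlieC X Y : tlie X Y + tlie Y X = 0.
Proof.
elim/tensor_ind: X => [x u|X1 X2 IH1 IH2]; last first.
  by rewrite tlieDl tlieDr addrACA IH1 IH2 addr0.
elim/tensor_ind: Y => [y v|Y1 Y2 IH1 IH2]; last first.
  by rewrite tlieDl tlieDr addrACA IH1 IH2 addr0.
by rewrite !tlie_tens [v * u]mulrC -linearDl lieC linear0l.
Qed.

Fact tliexx X : tlie X X = 0.
Proof.
elim/tensor_ind: X => [x u|X Y X0 Y0]; first by rewrite tlie_tens liexx linear0l.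
by rewrite tlieDl !tlieDr X0 Y0 addr0 add0r tlieC.
Qed.

Fact tlie_jacobi X Y Z :
  tlie X (tlie Y Z) + tlie Y (tlie Z X) + tlie Z (tlie X Y) = 0.
Proof.
have E (a b c d e f : tensor g W) :
    a + b + (c + d) + (e + f) = a + c + e + (b + d + f).
  by rewrite [a + b + _]addrACA [LHS]addrACA.
elim/tensor_ind: X => [x u|X1 X2 IH1 IH2]; last first.
  by rewrite !(tlieDl, tlieDr) E IH1 IH2 addr0.
elim/tensor_ind: Y => [y v|Y1 Y2 IH1 IH2]; last first.
  by rewrite !(tlieDl, tlieDr) E IH1 IH2 addr0.
elim/tensor_ind: Z => [z w|Z1 Z2 IH1 IH2]; last first.
  by rewrite !(tlieDl, tlieDr) E IH1 IH2 addr0.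
rewrite !tlie_tens [v * (w * u)]mulrCA [v * u]mulrC [w * (u * v)]mulrC.
by rewrite -[u * v * w]mulrA -!linearDl lie_jacobi linear0l.
Qed.

HB.instance Definition _ := Vector_isLieAlgebra.Build K (tensor g W)
  tlie_linearl tlie_linearr tliexx tlie_jacobi.

Lemma lie_tens x y u v : [lie x ⊗ u, y ⊗ v] = [lie x, y] ⊗ (u * v).
Proof. exact: tlie_tens. Qed.

End TensorLie.

(* Main.v *)
Require Import Defs.
From HB Require Import structures.
From mathcomp Require Import all_boot all_order all_algebra.
From mathcomp Require Import reals.

Set Implicit Arguments.
Unset Strict Implicit.
Unset Printing Implicit Defensive.

Import Order.TTheory GRing.Theory Num.Theory.
Local Open Scope ring_scope.

(** Both [V0p] and [V0m] are lines, spanned by [ep] and [em]: for [V0m] this follows from the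
    dimension bound [dim_orthov_definite]. By [tensv_vlineP] every element of [Vp] or [Vm] is then a
    pure tensor [x ⊗ ep] or [y ⊗ em], and on such a pair the claim reduces to the scalar identity
    [qM]. *)

Lemma vline_dim1 (K : fieldType) (V : vectType K) (U : {vspace V}) (v : V) :
  (\dim U <= 1)%N -> v \in U -> v != 0 -> U = <[v]>%VS.
Proof.
move=> dimU vU v_neq0; apply/esym/eqP.
by rewrite eqEdim -memvE vU dim_vline v_neq0.
Qed.

(** A nonzero vector of [U] orthogonal to all of [U] would be orthogonal to itself, against
    positivity; so [U] meets its orthogonal trivially and their sum is direct inside [W]. *)
Lemma dim_orthov_definite (R : numFieldType) (W : finComAlgType R)
    (theta : {scalar W}) (U : {vspace W}) :
    (forall w, w \in U -> w != 0 -> 0 < trace_form theta w w) ->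
  (\dim U + \dim (orthov (trace_form theta) U) <= \dim {:W})%N.
Proof.
move=> U_pos; rewrite -dimv_disjoint_sum ?dimvS ?subvf //.
apply/eqP; rewrite -subv0; apply/subvP=> w; rewrite memv_cap memv0.
case/andP=> wU /mem_orthovP/(_ w wU) ww0; apply: contraT => /(U_pos w wU).
by rewrite ww0 ltxx.
Qed.

(** The tensors [u ⊗ v] with [v] fixed form a subspace, the image of the linear map [f], so testing
    generators is enough. *)
Lemma tensv_vlineP (K : fieldType) (U V : vectType K) (v : V)
    (X : tensor U V) :
  X \in tensv fullv <[v]> -> exists u, X = u ⊗ v.
Proof.
pose f : {linear U -> tensor U V} := applyr (@tens K U V) v.
suff /subvP sub : (tensv fullv <[v]> <= limg (linfun f))%VS.
  by move=> /sub/memv_imgP[u _ ->]; exists u; rewrite lfunE.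
apply/tensv_subP => u _ _ /vlineP[k ->].
(* The scalar moves across: [u ⊗ (k *: v) = (k *: u) ⊗ v]. *)
rewrite linearZr_LR /= -linearZl_LR -[X in X \in _](lfunE f).
exact/memv_img/memvf.
Qed.

Theorem proposition2 (R : realType)
    (g : lieAlgType R) (ip : {dot g for idfun})
    (ip_invariant : forall x y z : g, ip [lie x, y] z = ip x [lie y, z])
    (W : finComAlgType R) (dimW : \dim {:W} = 2%N)
    (theta : {scalar W})
    (theta_nondeg : nondegenerate (trace_form theta))
    (theta_indef : indefinite (trace_form theta))
    (V0p V0m : {vspace W}) (dimV0p : \dim V0p = 1%N)
    (V0p_pos : forall w, w \in V0p -> w != 0 -> 0 < trace_form theta w w)
    (V0mE : V0m = orthov (trace_form theta) V0p)
    (ep em : W) (epV : ep \in V0p) (ep_neq0 : ep != 0)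
    (emV : em \in V0m) (em_neq0 : em != 0)
    (q : {scalar W}) (qM : q ep * q em = q (ep * em)) :
  let Vp : {vspace tensor g W} := tensv fullv V0p in
  let Vm : {vspace tensor g W} := tensv fullv V0m in
  let p : tensor g W -> g := id_tensor q in
  forall X Y : tensor g W, X \in Vp -> Y \in Vm ->
    [lie p X, p Y] = p [lie X, Y].
Proof.
move=> Vp Vm p X Y.
have V0m_le1 : (\dim V0m <= 1)%N.
  by have := dim_orthov_definite V0p_pos; rewrite -V0mE dimV0p dimW.
rewrite /Vp /Vm (vline_dim1 _ epV ep_neq0) ?dimV0p //.
rewrite (vline_dim1 V0m_le1 emV em_neq0).
move=> /tensv_vlineP[x ->] /tensv_vlineP[y ->].
(* The two sides are [q ep * q em] and [q (ep * em)] times [[lie x, y]]. *)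
by rewrite lie_tens /p !id_tensorE linearZl_LR linearZr_LR /= scalerA qM.
Qed.
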